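(* Let $\mathbf{x}=(x_1,\dots,x_n)$ be an $n$-periodic trajectory of the discrete Lagrangian system with configuration space $M$, $\dim M=m$, and Lagrangian $L$. Put $B_i=B(x_i,x_{i+1})$ for $i=1,\dots,n$ ($x_{n+1}=x_1$), let $P$ be the linear Poincaré map (monodromy matrix) of the trajectory and let $\mathbf{H}=\partial^2\mathscr{A}(\mathbf{x})/\partial\mathbf{x}^2$ be the Hessian matrix of the action functional $\mathscr{A}$ at $\mathbf{x}$ (all determinants computed in local coordinates chosen near each $x_i$). Then $$\det(P-I)=\frac{(-1)^{m}\det\mathbf{H}}{\prod_{i=1}^n \det B_{i}}=\sigma (-1)^m \beta \det\mathbf{H},$$ where $$\sigma=\sigma(\mathbf{x})=\operatorname{sign}\prod_{i=1}^n \det B_{i},\qquad \beta=\Bigl|\prod_{i=1}^n \det B_{i}\Bigr|^{-1}.$$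
   Context: $M$ is an $m$-dimensional manifold and $L$ a smooth ($C^2$ is enough) function on $M\times M$. $\partial_1L,\partial_2L$ denote the differentials of $L(x,y)$ in $x$ and $y$. $B(x,y)=-\partial_1\partial_2 L(x,y)$ is a linear operator $T_xM\to T_y^*M$ (a bilinear form on $T_xM\times T_yM$), in local coordinates $B(x,y)=-\bigl(\partial^2L/\partial y_j\partial x_i\bigr)$. Twist condition: $B(x,y)$ is nondegenerate (it suffices to assume this near the periodic trajectory considered). The discrete Lagrangian system (DLS) is the locally defined map $T(x,y)=(y,z)$, where $z$ is determined by $\partial_2L(x,y)+\partial_1L(y,z)=0$. An $n$-periodic trajectory is a sequence $(x_i)_{i\in\mathbb{Z}}$ in $M$, $x_{i+n}=x_i$, with $\partial_2L(x_{i-1},x_i)+\partial_1L(x_i,x_{i+1})=0$ for all $i$ (and $T$ is the local branch with $T(x_{i-1},x_i)=(x_i,x_{i+1})$); equivalently $\mathbf{x}=(x_1,\dots,x_n)$ is a critical point of $\mathscr{A}(\mathbf{x})=\sum_{i=1}^nL(x_i,x_{i+1})$, $x_{n+1}=x_1$, on $M^n$. The linear Poincaré map is $P=D(T^n)(x_1,x_2)$ acting on $T_{(x_1,x_2)}M^2$. *)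

(* Defs.v *)
From HB Require Import structures.
From mathcomp Require Import all_boot all_order all_algebra.
From mathcomp Require Import all_classical all_reals all_analysis.
Set Implicit Arguments.
Unset Strict Implicit.
Unset Printing Implicit Defensive.
Import Order.TTheory GRing.Theory Num.Theory.
Import numFieldNormedType.Exports.
Local Open Scope classical_set_scope.
Local Open Scope ring_scope.

(* [f] is of class C^k on [D]. It is meant for open [D] and finite-dimensional
   [V], where continuity of all iterated directional derivatives is equivalent
   to continuity of the iterated Frechet derivatives. *)
Fixpoint Ck (R : realType) (V W : normedModType R) (k : nat)
    (D : set V) (f : V -> W) {struct k} : Prop :=
  if k is k'.+1 then
    (forall x, D x -> differentiable f x) /\
    (forall v : V, Ck k' D (fun x => 'D_v f x : W))
  else forall x, D x -> {for x, continuous f}.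

(* [chart_map] and [chart_inv] are total functions, meaningful only on
   [chart_dom] and [chart_cod] respectively. *)
Record chart (R : realType) (M : topologicalType) (m : nat) := Chart {
  chart_dom : set M;
  chart_map : M -> 'rV[R]_m;
  chart_inv : 'rV[R]_m -> M
}.

Definition chart_cod (R : realType) (M : topologicalType) (m : nat)
  (c : chart R M m) : set 'rV[R]_m := chart_map c @` chart_dom c.

Definition is_chart (R : realType) (M : topologicalType) (m : nat)
    (c : chart R M m) : Prop :=
  [/\ open (chart_dom c), open (chart_cod c),
      forall x, chart_dom c x -> chart_inv c (chart_map c x) = x,
      forall x, chart_dom c x -> {for x, continuous (chart_map c)}
    & forall u, chart_cod c u -> {for u, continuous (chart_inv c)}].

(* The atlas is not assumed maximal. C^2 transition maps are what is needed for
   C^2 functions on [M * M]; smooth manifolds are a special case. *)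
Record manifold (R : realType) (M : topologicalType) (m : nat) := Manifold {
  atlas : set (chart R M m);
  manifold_hausdorff : hausdorff_space M;
  manifold_second_countable : @second_countable M;
  atlas_chart : forall c, atlas c -> is_chart c;
  atlas_cover : forall x : M, exists2 c, atlas c & chart_dom c x;
  atlas_compat : forall c c', atlas c -> atlas c' ->
    Ck 2 (chart_cod c `&` chart_inv c @^-1` chart_dom c')
         (chart_map c' \o chart_inv c)
}.

Section DiscreteLagrangianSystem.
Variables (R : realType) (M : topologicalType) (m : nat).
Variables (A : manifold R M m) (L : M * M -> R).
Implicit Types (c : chart R M m) (x y z : M).

Definition C2_lagrangian : Prop := forall c c', atlas A c -> atlas A c' ->
  Ck 2 (chart_cod c `*` chart_cod c')
    (fun uv : 'rV[R]_m * 'rV[R]_m =>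
       L (chart_inv c uv.1, chart_inv c' uv.2) : R).

(* Components of the covectors d_1 L(x, y) and d_2 L(x, y) in a chart around
   [x], respectively around [y]. *)
Definition d1 c x y : 'rV[R]_m :=
  \row_a 'D_(delta_mx 0 a) (fun u => L (chart_inv c u, y)) (chart_map c x).

Definition d2 c x y : 'rV[R]_m :=
  \row_a 'D_(delta_mx 0 a) (fun v => L (x, chart_inv c v)) (chart_map c y).

(* d_2 L(x, y) + d_1 L(y, z) = 0 in the cotangent space at [y]. *)
Definition dls_equation x y z : Prop :=
  forall c, atlas A c -> chart_dom c y -> d2 c x y + d1 c y z = 0.

(* Matrix of B(x, y) = - d_1 d_2 L(x, y), with [c] a chart around [x] and [c']
   a chart around [y]. *)
Definition Bmx c c' x y : 'M[R]_m :=
  \matrix_(i, j) - 'D_(delta_mx 0 j)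
    (fun v => 'D_(delta_mx 0 i)
       (fun u => L (chart_inv c u, chart_inv c' v)) (chart_map c x) : R)
    (chart_map c' y).

Definition twist x y : Prop := forall c c', atlas A c -> atlas A c' ->
  chart_dom c x -> chart_dom c' y -> \det (Bmx c c' x y) != 0.

Definition periodic_trajectory (n : nat) (x : int -> M) : Prop :=
  (forall i, x (i + n%:Z) = x i) /\
  (forall i, dls_equation (x (i - 1)) (x i) (x (i + 1))).

(* [T] is the branch of (x, y) |-> (y, z) which sends (x0, y0) to (y0, z0);
   only its values near (x0, y0) are relevant. *)
Definition dls_branch (T : M * M -> M * M) x0 y0 z0 : Prop :=
  [/\ T (x0, y0) = (y0, z0), {for (x0, y0), continuous T}
    & \forall p \near (x0, y0),
        (T p).1 = p.2 /\ dls_equation p.1 p.2 (T p).2].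

(* T_n \o ... \o T_1. If all the branches [T i] are restrictions of one map [T],
   this is its n-th iterate. *)
Fixpoint branch_iter (T : int -> M * M -> M * M) (n : nat) : M * M -> M * M :=
  if n is n'.+1 then T n'.+1%:Z \o branch_iter T n' else id.

Definition pair_map c c' (p : M * M) : 'rV[R]_(m + m) :=
  row_mx (chart_map c p.1) (chart_map c' p.2).

Definition pair_inv c c' (w : 'rV[R]_(m + m)) : M * M :=
  (chart_inv c (lsubmx w), chart_inv c' (rsubmx w)).

Definition in_pair_coords c c' (F : M * M -> M * M) :
    'rV[R]_(m + m) -> 'rV[R]_(m + m) :=
  pair_map c c' \o F \o pair_inv c c'.

(* Matrix of the derivative of [F] at a fixed point [p]; it acts on row
   vectors. *)
Definition derivative_mx c c' (F : M * M -> M * M) (p : M * M) :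
    'M[R]_(m + m) :=
  lin1_mx ('d (in_pair_coords c c' F) (pair_map c c' p)).

(* The indices are in 'I_n, with [ordS] the cyclic successor. *)
Definition action (n : nat) (X : 'I_n -> M) : R :=
  \sum_(i < n) L (X i, X (ordS i)).

Definition hessian (k : nat) (f : 'rV[R]_k -> R) (u : 'rV[R]_k) : 'M[R]_k :=
  \matrix_(p, q) 'D_(delta_mx 0 p) (fun v => 'D_(delta_mx 0 q) f v : R) u.

(* The charts [C i] on the n factors of M^n form a chart with values in
   R^(n * m), n-tuples of row vectors of size m being flattened by [mxvec]. *)
Definition action_hessian (n : nat) (C : 'I_n -> chart R M m) (X : 'I_n -> M) :
    'M[R]_(n * m) :=
  hessian (fun u => action (fun i => chart_inv (C i) (row i (vec_mx u))))
          (mxvec (\matrix_(i < n) chart_map (C i) (X i))).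

End DiscreteLagrangianSystem.

(* Main.v *)
Require Import Defs.
From HB Require Import structures.
From mathcomp Require Import all_boot all_order all_algebra.
From mathcomp Require Import fingroup perm.
From mathcomp Require Import all_classical all_reals all_analysis.
From mathcomp Require Import ring lra.
Set Implicit Arguments.
Unset Strict Implicit.
Unset Printing Implicit Defensive.
Import Order.TTheory GRing.Theory Num.Theory.
Import numFieldNormedType.Exports.
Local Open Scope classical_set_scope.
Local Open Scope ring_scope.

(** In charts around the points of the trajectory the Lagrangian of the i-th
    link becomes a C^2 function L_i (u, v) on an open subset of R^m x R^m.
    Derivatives of vectors are written as row vectors multiplied on the right
    by matrices; S_i, G_i and E_i, Q_i denote the derivatives of d_2 L_i and of
    d_1 L_i in the first and in the second variable. Thus the matrix B_i of the
    statement is - Q_i^T. The linearization along the trajectory is the second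
    order recurrence

      xi_i S_i + xi_(i+1) (G_i + E_(i+1)) + xi_(i+2) Q_(i+1) = 0.

    Neither the symmetry of second derivatives nor the existence part of the
    implicit function theorem is needed. A branch T_i is given and continuous,
    so only its differentiability has to be obtained from the equation
    d_2 L_i (u, v) + d_1 L_(i+1) (v, w) = 0 and from the invertibility of
    Q_(i+1) ([differentiable_implicit], [is_diff_branch]). By the chain rule
    the linear Poincare map P is then the [transfer] matrix of the recurrence,
    which sends (xi_1, xi_2) to (xi_(n+1), xi_(n+2)) ([is_diff_branch_iter]).

    On the other side the Hessian H of the action is the cyclic block
    tridiagonal matrix whose j-th block column is the left-hand side of the
    recurrence, the indices being taken modulo n ([action_hessianE]).

    It remains to compare the determinant of H with that of 1 - P. Up to a
    cyclic shift of the block columns, of sign (-1)^((n-1) m), the matrix H has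
    the Q_i on its block diagonal. Dropping the blocks that wrap around leaves
    a block triangular matrix V of determinant det Q_1 ... det Q_n. Let W be
    the block row of the solutions of the recurrence whose initial values are
    the canonical ones. As W solves the recurrence, W V is opposite to the
    contribution of the initial values, and the shifted H is (1 - C W) V, where
    C extracts from an n-tuple its last two entries as initial values. By
    det (1 - C W) = det (1 - W C) and W C = P, this gives
    det H = (-1)^((n-1) m) det (1 - P) det Q_1 ... det Q_n
    ([det_cyclic_block], [det_periodic_tridiag]). When n = 1 the last two
    entries coincide, W C is no longer P, but det (1 - W C) = det (1 - P) still
    holds. *)

(** * Determinants of block matrices and cyclic recurrences *)

Section Determinants.
Variable F : comUnitRingType.

Lemma det_castmx p q (e : p = q) (A : 'M[F]_p) : \det (castmx (e, e) A) = \det A.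
Proof. by case: q / e; rewrite castmx_id. Qed.

(** Renumbering rows and columns in the same way preserves the determinant. *)
Lemma det_mxsub_inj p q (f : 'I_p -> 'I_q) (A : 'M[F]_q) :
  p = q -> injective f -> \det (mxsub f f A) = \det A.
Proof.
move=> pq f_inj; case: q / pq in f f_inj A *.
have -> : mxsub f f A = row_perm (perm f_inj) (col_perm (perm f_inj) A).
  by apply/matrixP => i j; rewrite !mxE !permE.
rewrite row_permE col_permE !det_mulmx !det_perm odd_permV mulrCA -signr_addb.
by rewrite addbb mulr1.
Qed.

Lemma det_mxblock_utrig n (p_ : 'I_n -> nat) (B : forall i j, 'M[F]_(p_ i, p_ j)) :
  (forall i j : 'I_n, (j < i)%N -> B i j = 0) ->
  \det (\mxblock_(i, j) B i j) = \prod_i \det (B i i).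
Proof.
elim: n p_ B => [|n IHn] p_ B B0.
  have det1_0 k (A : 'M[F]_k) : k = 0%N -> \det A = 1.
    by move=> k0; move: A; rewrite k0 => A; exact: det_mx00.
  by rewrite det1_0 ?big_ord0.
rewrite mxblock_recul det_castmx big_ord_recl.
have -> : \mxcol_i B (lift ord0 i) ord0 = 0.
  by rewrite -mxcol0; apply: eq_mxcol => i; rewrite B0.
rewrite det_ublock; congr (_ * _); apply: IHn => i j ji.
by rewrite B0.
Qed.

(** Sylvester's identity: both sides are the determinant of the block matrix
    with identity diagonal blocks and off-diagonal blocks [C] and [W]. *)
Lemma det_1B_mulmxC p q (C : 'M[F]_(p, q)) (W : 'M[F]_(q, p)) :
  \det (1%:M - C *m W) = \det (1%:M - W *m C).
Proof.
transitivity (\det (block_mx 1%:M C W 1%:M)).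
  have -> : block_mx 1%:M C W 1%:M =
      block_mx (1%:M - C *m W) C 0 1%:M *m block_mx 1%:M 0 W 1%:M.
    by rewrite mulmx_block !mulmx1 ?mulmx0 ?mul1mx ?mul0mx ?addr0 ?add0r subrK.
  by rewrite det_mulmx det_ublock det_lblock !det1 !mulr1.
have -> : block_mx 1%:M C W 1%:M =
    block_mx 1%:M 0 W 1%:M *m block_mx 1%:M C 0 (1%:M - W *m C).
  by rewrite mulmx_block ?mulmx1 ?mulmx0 ?mul1mx ?mul0mx ?addr0 addrC subrK.
by rewrite det_mulmx det_ublock det_lblock !det1 !mul1r.
Qed.

Lemma ordS_bij n : bijective (@ordS n).
Proof. exact: Bijective (@ordSK n) (@ord_predK n). Qed.

Lemma odd_perm_ordS n : odd_perm (perm (bij_inj (ordS_bij n.+1))) = odd n.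
Proof.
set s := perm _.
(* the cyclic successor has a single orbit *)
have porb i : i \in porbit s ord0.
  suff -> : i = (s ^+ i)%g ord0 by exact: mem_porbit.
  apply: val_inj; case: i => i /=; elim: i => [|i IHi] lti.
    by rewrite expg0 perm1.
  by rewrite expgSr permM permE /= -IHi ?modn_small // ltnW.
have porbs : #|porbits s| = 1%N.
  apply/eqP/cards1P; exists (porbit s ord0); apply/setP => O.
  rewrite inE; apply/imsetP/eqP => [[i _ ->]|->]; last by exists ord0.
  by apply/eqP; rewrite eq_porbit_mem.
by rewrite /odd_perm porbs card_ord addbT /= negbK.
Qed.

(** The sign of a cyclic shift of [n.+1] block columns of width [m]. *)
Lemma det_mxblock_ordS n m (B : 'I_n.+1 -> 'I_n.+1 -> 'M[F]_m) :
  \det (\mxblock_(i, j) B i (ordS j)) =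
  (-1) ^+ (n * m) * \det (\mxblock_(i, j) B i j).
Proof.
pose Z : 'M[F]_n.+1 := \matrix_(i, j) (i == ordS j)%:R.
have detZ : \det Z = (-1) ^+ n.
  have -> : Z = perm_mx (perm (bij_inj (ordS_bij n.+1)))^-1.
    apply/matrixP => i j; rewrite !mxE; congr (nat_of_bool _)%:R.
    rewrite -[RHS](inj_eq (@perm_inj _ (perm (bij_inj (ordS_bij n.+1))))).
    by rewrite permKV permE.
  by rewrite det_perm odd_permV odd_perm_ordS signr_odd.
(* The shift is the Kronecker product of [Z] and the identity of size [m];
   exchanging the two index levels by [f] turns it into the block diagonal
   matrix [DZ] with [m] diagonal blocks [Z]. *)
pose f (k : 'I_(\sum_(i < n.+1) m)) : 'I_(\sum_(a < m) n.+1) :=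
  tagnat.Rank (tagnat.sig2 k) (tagnat.sig1 k).
have f_inj : injective f.
  move=> k l /(congr1 val)/eqP; rewrite /= tagnat.eq_Rank.
  move=> /andP[/eqP e2 /eqP e1].
  rewrite -[k]tagnat.sig2K -[l]tagnat.sig2K; apply/val_inj/eqP.
  rewrite /= tagnat.eq_Rank; apply/andP; split; apply/eqP.
    exact/val_inj.
  by rewrite e2.
have -> : \mxblock_(i, j) B i (ordS j) = (\mxblock_(i, j) B i j) *m
   (\mxblock_(i < n.+1, j < n.+1) ((Z i j)%:M : 'M[F]_(m, m))).
  rewrite mul_mxblock; apply: eq_mxblock => i j.
  rewrite (bigD1 (ordS j)) //= big1 ?addr0 => [|k /negPf kj].
    by rewrite mxE eqxx mulmx1.
  by rewrite mxE kj raddf0 mulmx0.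
rewrite det_mulmx mulrC; congr (_ * _).
pose DZ : 'M[F]_(\sum_(a < m) n.+1) := \mxblock_(a, b) (if a == b then Z else 0).
have -> : \mxblock_(i < n.+1, j < n.+1) ((Z i j)%:M : 'M[F]_(m, m)) =
    mxsub f f DZ.
  apply/matrixP => k l; rewrite !mxE /f !tagnat.Rank1K.
  rewrite !tagnat.Rank2K; case: (tagnat.sig2 k == tagnat.sig2 l).
    by rewrite !mxE mulr1n -!val_eqE.
  by rewrite mulr0n mxE.
rewrite det_mxsub_inj ?sum_nat_const ?card_ord ?[(m * _)%N]mulnC //.
rewrite det_mxblock_utrig => [|i j ji]; last by rewrite -val_eqE gtn_eqF.
under eq_bigr do rewrite eqxx detZ.
by rewrite prodr_const card_ord exprM.
Qed.

Lemma ordS_eq0 n (k : 'I_n.+1) : (ordS k == ord0) = (k == n :> nat).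
Proof.
rewrite -val_eqE /=; have [kn|nk] := ltnP k n.
  by rewrite modn_small // (ltn_eqF kn).
have -> : k = n :> nat by apply/eqP; rewrite eqn_leq nk -ltnS ltn_ord.
by rewrite modnn !eqxx.
Qed.

(** The cyclic successor differs from the successor only by wrapping [n] around
    to [0]; the equality of booleans is stated in [nat] to serve as a
    multiplicity. *)
Lemma eq_ordS n (i k : 'I_n.+1) :
  (i == ordS k) = ((i == k.+1 :> nat) + (ordS k == ord0) * (i == 0%N :> nat))%N
  :> nat.
Proof.
rewrite -!val_eqE /=; have [kn|nk] := ltnP k n.
  by rewrite modn_small //= mul0n addn0.
have -> : k = n :> nat by apply/eqP; rewrite eqn_leq nk -ltnS ltn_ord.
by rewrite modnn mul1n (@ltn_eqF i n.+1).
Qed.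

Lemma eq_ordSS n (i k : 'I_n.+1) :
  (i == ordS (ordS k)) = ((i == k.+2 :> nat)
     + (ordS (ordS k) == ord0) * (i == 0%N :> nat)
     + (ordS k == ord0) * (i == 1%N :> nat))%N :> nat.
Proof.
rewrite (eq_ordS i (ordS k)) addnAC; congr (_ + _)%N.
rewrite -!val_eqE /=; have [kn|nk] := ltnP k n.
  by rewrite modn_small //= mul0n addn0.
have -> : k = n :> nat by apply/eqP; rewrite eqn_leq nk -ltnS ltn_ord.
by rewrite modnn mul1n (@ltn_eqF i n.+2) // ltnW // ltnS.
Qed.

Lemma sum_mulrb_pick (V : nmodType) (I : finType) (P : pred I) (G : I -> V) j :
  P =1 pred1 j -> \sum_i G i *+ P i = G j.
Proof.
move=> Pj; rewrite (bigD1 j) //= big1 => [|i /negPf ij].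
  by rewrite Pj /= eqxx addr0.
by rewrite Pj /= ij.
Qed.

Section CyclicRecurrence.
Variables (m : nat) (S D Q : nat -> 'M[F]_m).

(** One step (xi_k, xi_(k+1)) -> (xi_(k+1), xi_(k+2)) of the recurrence
    xi_k S_k + xi_(k+1) D_k + xi_(k+2) Q_k = 0, acting on row vectors. *)
Definition recurrence_step k : 'M[F]_(m + m) :=
  block_mx 0 (- (S k *m invmx (Q k))) 1%:M (- (D k *m invmx (Q k))).

(** The product of the first [k] steps; since row vectors are multiplied on the
    right, later steps are further to the right. *)
Fixpoint transfer k : 'M[F]_(m + m) :=
  if k is k'.+1 then transfer k' *m recurrence_step k' else 1%:M.

(** Blocks of the matrix of the cyclic recurrence: column [i] is the equation
    whose leading unknown, with coefficient [Q i], has index [i], the two other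
    unknowns being its cyclic predecessors. *)
Definition cyclic_block n (k i : 'I_n) : 'M[F]_m :=
  Q i *+ (i == k) + D i *+ (i == ordS k) + S i *+ (i == ordS (ordS k)).

(** By this lemma and the next one the right halves of the transfer matrices are
    the solutions of the recurrence with canonical initial values. *)
Lemma lsubmx_transferS k : lsubmx (transfer k.+1) = rsubmx (transfer k).
Proof.
rewrite /= -{1}[transfer k]hsubmxK mul_row_block mulmx0 mulmx1 add0r.
by rewrite row_mxKl.
Qed.

Lemma rsubmx_transferS k : Q k \in unitmx ->
  rsubmx (transfer k.+1) *m Q k + rsubmx (transfer k) *m D k
    + lsubmx (transfer k) *m S k = 0.
Proof.
move=> Qk; rewrite /= -{1}[transfer k]hsubmxK mul_row_block row_mxKr.
rewrite !mulmxN mulmxDl !mulNmx -!mulmxA mulVmx // !mulmx1.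
by rewrite -addrA -opprD [rsubmx _ *m _ + _]addrC addNr.
Qed.

Lemma det_cyclic_block n : (forall k, (k < n.+1)%N -> Q k \in unitmx) ->
  \det (\mxblock_(k < n.+1, i < n.+1) cyclic_block k i)
  = (\prod_(i < n.+1) \det (Q i)) * \det (1%:M - transfer n.+1).
Proof.
move=> Q_unit.
(* [V] consists of the blocks that do not wrap around, [w k] is the solution at
   time [k], the initial values being at times -2 and -1, and [C] maps an
   [n.+1]-tuple to its last two entries. *)
pose V (k i : 'I_n.+1) : 'M[F]_m := Q i *+ (i == k)
   + D i *+ (nat_of_ord i == k.+1) + S i *+ (nat_of_ord i == k.+2).
pose w k := rsubmx (transfer k.+1).
pose C (k : 'I_n.+1) : 'M[F]_(m, m + m) :=
  row_mx 1%:M 0 *+ (ordS (ordS k) == ord0) + row_mx 0 1%:M *+ (ordS k == ord0).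
have sum0 (G : 'I_n.+1 -> 'M[F]_(m + m, m)) : \sum_(k < n.+1) G k *+ 0 = 0.
  by rewrite big1 // => k _; rewrite mulr0n.
have wV (i : 'I_n.+1) : \sum_(k < n.+1) w k *m V k i =
   - (rsubmx (transfer 0) *m (D i *+ (i == 0%N :> nat)) +
      lsubmx (transfer 0) *m (S i *+ (i == 0%N :> nat)) +
      rsubmx (transfer 0) *m (S i *+ (i == 1%N :> nat))).
  under eq_bigr => k _ do rewrite /V !mulmxDr !(raddfMn (mulmx (w k))) /=.
  rewrite !big_split /= (@sum_mulrb_pick _ _ _ _ i); last first.
    by move=> k; rewrite /= eq_sym.
  have := rsubmx_transferS (Q_unit i (ltn_ord i)).
  case: i => -[|[|i]] lti; rewrite ?lsubmx_transferS /= => H.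
  - rewrite !sum0 !addr0 !mulr1n mulr0n mulmx0 addr0.
    by apply/eqP; rewrite -addr_eq0 addrA; apply/eqP.
  - rewrite sum0 (@sum_mulrb_pick _ _ _ _ (Ordinal (ltnW lti))) //.
    rewrite !mulr0n !mulmx0 add0r add0r addr0 mulr1n.
    by apply/eqP; rewrite -addr_eq0; apply/eqP; rewrite -[RHS]H.
  - rewrite (@sum_mulrb_pick _ _ _ _ (Ordinal (ltnW lti))) //.
    rewrite (@sum_mulrb_pick _ _ _ _ (Ordinal (ltnW (ltnW lti)))) //.
    by rewrite !mulr0n !mulmx0 !addr0 oppr0 -[RHS]H.
have VE : \mxblock_(k < n.+1, i < n.+1) cyclic_block k i =
   (1%:M - (\mxcol_k C k) *m (\mxrow_(k < n.+1) w k)) *m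
   \mxblock_(k < n.+1, i < n.+1) V k i.
  rewrite mulmxBl mul1mx -mulmxA mul_mxrow_mxblock mul_mxcol_mxrow -mxblockB.
  apply: eq_mxblock => k i; rewrite wV.
  have C0 : C k *m lsubmx (transfer 0) = 1%:M *+ (ordS (ordS k) == ord0).
    rewrite [transfer 0]scalar_mx_block block_mxEh row_mxKl /C.
    by do 2!case: (_ == ord0);
       rewrite !(mulr0n, mulr1n) !(mulmxDl, mul_row_col, mul0mx)
               !(mulmx0, mulmx1, addr0, add0r).
  have C1 : C k *m rsubmx (transfer 0) = 1%:M *+ (ordS k == ord0).
    rewrite [transfer 0]scalar_mx_block block_mxEh row_mxKr /C.
    by do 2!case: (_ == ord0);
       rewrite !(mulr0n, mulr1n) !(mulmxDl, mul_row_col, mul0mx)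
               !(mulmx0, mulmx1, addr0, add0r).
  rewrite mulmxN opprK !mulmxDr !mulmxA C0 C1 /cyclic_block eq_ordS eq_ordSS.
  have mul1b (b1 b2 : bool) (A : 'M[F]_m) :
      1%:M *+ b1 *m (A *+ b2) = A *+ (b1 * b2).
    by case: b1; case: b2; rewrite !(mulr0n, mulr1n) ?mulmx0 ?mul0mx ?mul1mx.
  rewrite !mul1b !mulrnDr /V -!addrA; congr (_ + (_ + _)).
  by rewrite [RHS]addrCA.
rewrite VE det_mulmx mulrC det_mxblock_utrig; last first.
  move=> k i ik; rewrite /V -val_eqE !(ltn_eqF ik) ?mulr0n.
  by rewrite !ltn_eqF ?mulr0n ?addr0 // !ltnS ltnW // ltnW.
congr (_ * _).
  by apply: eq_bigr => i _; rewrite /V eqxx !ltn_eqF ?mulr0n ?addr0.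
rewrite det_1B_mulmxC mul_mxrow_mxcol.
have wC : \sum_(k < n.+1) w k *m C k = row_mx (w n.-1) (w n).
  rewrite (eq_bigr (fun k : 'I_n.+1 =>
      row_mx (w k) 0 *+ (ordS (ordS k) == ord0) +
      row_mx 0 (w k) *+ (ordS k == ord0))); last first.
    move=> k _; rewrite mulmxDr !(raddfMn (mulmx (w k))) /=.
    by rewrite !mul_mx_row !mulmx1 !mulmx0.
  have ltn1 : (n.-1 < n.+1)%N by rewrite ltnS leq_pred.
  rewrite big_split /= (@sum_mulrb_pick _ _ _ _ (Ordinal ltn1)); last first.
    move=> k; rewrite /= ordS_eq0 -val_eqE /=; have [kn|nk] := ltnP k n.
      by rewrite modn_small // -[RHS]eqSS (ltn_predK kn).
    have -> : k = n :> nat by apply/eqP; rewrite eqn_leq nk -ltnS ltn_ord.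
    by rewrite modnn; case: (n) => [|n0] //; rewrite [RHS]gtn_eqF.
  rewrite (@sum_mulrb_pick _ _ _ _ ord_max); last first.
    by move=> k; rewrite /= ordS_eq0 -val_eqE.
  by rewrite add_row_mx addr0 add0r.
rewrite wC {wC VE wV C V sum0 Q_unit}; case: n => [|n]; last first.
  by rewrite -[in RHS](hsubmxK (transfer n.+2)) lsubmx_transferS.
rewrite /w /= mul1mx /recurrence_step block_mxEh row_mxKr.
move: (- (S 0 *m _)) (- (D 0 *m _)) => s d.
(* For a cycle of length 1 the last two entries of a tuple are the same one, and
   the two matrices differ by a unipotent factor. *)
transitivity (\det ((1%:M - row_mx (col_mx s d) (col_mx s d)) *m
                    block_mx 1%:M 0 (- 1%:M) 1%:M)).
  by rewrite det_mulmx det_lblock !det1 !mulr1.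
congr (\det _); rewrite -!block_mxEh scalar_mx_block !opp_block_mx !add_block_mx.
rewrite mulmx_block !mulmx1 !mulmx0 !mulmxN !mulmx1 !add0r !subr0 !opprB.
by rewrite addKr opprK subrK.
Qed.
End CyclicRecurrence.

(** A matrix indexed by [mxvec_index] viewed as a block matrix, the blocks being
    permuted by [f]. *)
Lemma det_mxblock_mxvec n m (H : 'M[F]_(n * m)) (f : 'I_n -> 'I_n) :
  injective f ->
  \det (\mxblock_(k < n, i < n)
     (\matrix_(a, b) H (mxvec_index (f k) a) (mxvec_index (f i) b) : 'M[F]_(m, m)))
  = \det H.
Proof.
move=> f_inj.
pose g (k : 'I_(\sum_(i < n) m)) : 'I_(n * m) :=
  mxvec_index (f (tagnat.sig1 k)) (tagnat.sig2 k).
rewrite -(@det_mxsub_inj _ _ g) ?sum_nat_const ?card_ord //.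
  by congr (\det _); apply/matrixP => k l; rewrite !mxE.
move=> k l /(congr1 (fun i => vec_mx (delta_mx 0 i : 'rV[F]_(n * m)))).
rewrite /g !vec_mx_delta.
move=> /matrixP/(_ (f (tagnat.sig1 k)) (tagnat.sig2 k)); rewrite !mxE !eqxx /=.
case: andP => [[/eqP/f_inj e1 /eqP e2] _|_ /eqP]; last by rewrite oner_eq0.
rewrite -[k]tagnat.sig2K -[l]tagnat.sig2K; apply/val_inj/eqP.
by rewrite /= tagnat.eq_Rank e1 e2 !eqxx.
Qed.

Lemma periodic_ordS (T : Type) n (f : nat -> T) (i : 'I_n) :
  (forall k, f (k + n)%N = f k) -> f (ordS i).+1 = f i.+2.
Proof.
case: n i => [[]//|n] i fn /=; have [lt_in|le_ni] := ltnP i n.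
  by rewrite modn_small.
have -> : i = n :> nat by apply/eqP; rewrite eqn_leq le_ni -ltnS ltn_ord.
by rewrite modnn -(fn 1%N).
Qed.

(** The data are indexed by the links of the trajectory, the [k]-th link going
    from the [k]-th to the [k.+1]-st point, while [k : 'I_n] stands for the
    point of index [k.+1]; hence the successors. The initial values of the
    recurrence are those at the first and second points. *)
Lemma det_periodic_tridiag n m (E G S Q : nat -> 'M[F]_m) (H : 'M[F]_(n * m)) :
  (0 < n)%N ->
  (forall k, E (k + n)%N = E k) -> (forall k, Q (k + n)%N = Q k) ->
  (forall k, Q k \in unitmx) ->
  (forall (k j : 'I_n) a b, H (mxvec_index k a) (mxvec_index j b) =
    ((E j.+1 + G (ord_pred j).+1) *+ (k == j) + Q j.+1 *+ (k == ordS j)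
       + S k.+1 *+ (j == ordS k)) a b) ->
  \det H = (-1) ^+ (n.-1 * m) * (\prod_(i < n) \det (Q i.+1)) *
   \det (1%:M - transfer (fun i => S i.+1) (fun i => G i.+1 + E i.+2)
                          (fun i => Q i.+2) n).
Proof.
case: n H => // n H _ En Qn Q_unit HE.
have prodQ : \prod_(i < n.+1) \det (Q i.+1) = \prod_(i < n.+1) \det (Q i.+2).
  rewrite big_ord_recl big_ord_recr mulrC; congr (_ * _) => /=.
  by rewrite -(Qn 1%N).
rewrite prodQ -mulrA.
rewrite -det_cyclic_block; last by move=> k _; exact: Q_unit.
rewrite -det_mxblock_ordS.
(* The first unknown of the recurrence lies at the third point, whence a double
   shift of rows and columns; the equation of the [i]-th column is centred one
   point before its leading unknown, whence the further shift of columns. *)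
rewrite -(@det_mxblock_mxvec _ _ H (fun k => ordS (ordS k))); last first.
  by move=> k l /(bij_inj (ordS_bij _))/(bij_inj (ordS_bij _)).
congr (\det _); apply: eq_mxblock => k i; apply/matrixP => a b.
rewrite mxE HE ordSK /cyclic_block; congr fun_of_matrix.
rewrite !(inj_eq (bij_inj (ordS_bij _))) ![k == _]eq_sym.
rewrite (periodic_ordS (ordS i) En) (periodic_ordS (ordS i) Qn).
rewrite [G _ + E _]addrC [X in X + _ = _]addrC; congr (_ + _ + _).
by case: eqP => [->|].
Qed.

End Determinants.

(** * Derivatives *)

Section Calculus.
Variable R : realType.

(** Differentiability of [f] is not needed, as [g] is affine along the line. *)
Lemma derive_affine (U V W : normedModType R) (f : V -> W) (g : U -> V) a v w :
  (forall h : R, g (h *: v + a) = h *: w + g a) ->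
  'D_v (f \o g) a = 'D_w f (g a).
Proof.
move=> gE; rewrite /derive.
rewrite [X in lim (X @ _)](_ : _ = fun h : R =>
  h^-1 *: ((f \o shift (g a)) (h *: w) - f (g a))) //.
by apply/funext => h /=; rewrite gE.
Qed.

Lemma differentiable_rV (V : normedModType R) n (f : V -> 'rV[R]_n) x :
  (forall j, differentiable (fun y => f y 0 j : R) x) -> differentiable f x.
Proof.
move=> fd.
have -> : f = \sum_(j < n) (fun y => (f y 0 j : R) *: delta_mx 0 j).
  by apply/funext => y; rewrite [LHS]row_sum_delta fct_sumE.
by apply: differentiable_sum => j; exact: differentiableZl.
Qed.

Lemma differentiable_mulmxr p q (Q : 'M[R]_(p, q)) (x : 'rV[R]_p) :
  differentiable (mulmxr Q : 'rV[R]_p -> 'rV[R]_q) x.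
Proof.
have -> : (mulmxr Q : 'rV[R]_p -> 'rV[R]_q) =
    \sum_(k < p) (fun y : 'rV[R]_p => (y 0 k : R) *: row k Q).
  by apply/funext => y; rewrite /= mulmx_sum_row fct_sumE.
by apply: differentiable_sum => j; apply: differentiableZl; exact: differentiable_coord.
Qed.

Lemma mulmxr_continuous p q (Q : 'M[R]_(p, q)) :
  continuous (mulmxr Q : 'rV[R]_p -> 'rV[R]_q).
Proof. by move=> x; apply/differentiable_continuous/differentiable_mulmxr. Qed.

(** Implicit differentiation of a given continuous solution [w] of
    [Psi (p, w p) = 0]. With [d] the increment of [w] and [l] the expected
    differential, [(d - l h) Q] is, up to sign, the remainder of [Psi], hence
    o(|h| + |d|);
    as [Q] is invertible this first gives |d| = O(|h|), then d - l h = o(|h|).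
    The partial differential of [Psi] along the second factor is [eta *m Q]. *)
Lemma differentiable_implicit (U : normedModType R) m (w : U -> 'rV[R]_m)
    (Psi : U * 'rV[R]_m -> 'rV[R]_m) (p0 : U) (Q : 'M[R]_m) :
  {for p0, continuous w} -> differentiable Psi (p0, w p0) ->
  (forall eta, 'd Psi (p0, w p0) (0, eta) = eta *m Q) -> Q \in unitmx ->
  (\forall p \near p0, Psi (p, w p) = 0) ->
  differentiable w p0 /\
  forall xi, 'd w p0 xi = - ('d Psi (p0, w p0) (xi, 0) *m invmx Q).
Proof.
move=> w_cont dPsi dPsi2 Q_unit Psi0.
set a := (p0, w p0) in dPsi dPsi2 *.
pose l xi := - ('d Psi a (xi, 0) *m invmx Q).
have l_lin : linear l.
  move=> k u v; rewrite /l -(_ : k *: (u, 0) + (v, 0) = (k *: u + v, 0)).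
    by rewrite linearP mulmxDl -scalemxAl opprD scalerN.
  by rewrite -[RHS]/(k *: u + v, 0) -[LHS]/(k *: u + v, k *: 0 + 0) scaler0 addr0.
pose lM := GRing.isLinear.Build _ _ _ _ _ l_lin.
pose lL : {linear U -> 'rV[R]_m} := HB.pack l lM.
have l_cont : continuous lL.
  move=> u; apply: differentiable_continuous.
  apply: (@differentiableN _ _ _ (fun xi => 'd Psi a (xi, 0) *m invmx Q)).
  apply: (@differentiable_comp _ _ _ _ (fun xi => 'd Psi a (xi, 0)) (mulmxr (invmx Q))).
    apply: (@differentiable_comp _ _ _ _ (fun xi : U => (xi, 0 : 'rV[R]_m)) ('d Psi a)).
      by apply: differentiable_pair; [exact: ex_diff | exact: differentiable_cst].
    exact/linear_differentiable/diff_continuous.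
  exact: differentiable_mulmxr.
suff wE : w \o shift p0 = cst (w p0) + lL +o_ (0 : U) id.
  have dw := diff_unique l_cont wE.
  split; last by move=> xi; rewrite dw.
  by apply/diff_locallyP; rewrite dw.
have [K' K'0 lK'] := linear_lipschitz l_cont.
have [K K0 QK] := linear_lipschitz (@mulmxr_continuous _ _ (invmx Q)).
apply/eqaddoP => eps eps0.
(* The first bound on [e] gives |d| <= (1 + 2 K') |h|, the second one then gives
   |d - l h| <= eps |h|. *)
pose e := Num.min (2 * K)^-1 (eps / (K * (1 + 2 * K'))).
have e0 : 0 < e.
  by rewrite lt_min invr_gt0 divr_gt0 ?mulr_gt0 // ?addr_gt0 ?mulr_gt0.
have [_ /eqaddoP/(_ e e0) dPsiE] := (diff_locallyP _ _).1 dPsi.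
have Psia : Psi a = 0 by exact: nbhs_singleton Psi0.
have shift_cvg : (fun h : U => h + p0) @ (0 : U) --> p0.
  rewrite -[X in _ --> X]add0r; apply: cvgD; [exact: cvg_id | exact: cvg_cst].
have pair_cvg : (fun h : U => (h, w (h + p0) - w p0)) @ (0 : U) --> (0 : U, 0 : 'rV[R]_m).
  apply: (@cvg_pair _ _ _ (nbhs (0 : U)) (nbhs (0 : U)) (nbhs (0 : 'rV[R]_m))
    _ _ _ id (fun h => w (h + p0) - w p0)); first exact: cvg_id.
  rewrite -(subrr (w p0)); apply: cvgB; last exact: cvg_cst.
  exact: (cvg_comp _ _ shift_cvg w_cont).
near=> h.
have : `|Psi ((h, w (h + p0) - w p0) + a) -
     (Psi a + 'd Psi a (h, w (h + p0) - w p0))| <= e * `|(h, w (h + p0) - w p0)|.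
  near: h; exact: (pair_cvg _ dPsiE).
have -> : (h, w (h + p0) - w p0) + a = (h + p0, w (h + p0)).
  by rewrite /a -[LHS]/(h + p0, w (h + p0) - w p0 + w p0) subrK.
have -> : Psi (h + p0, w (h + p0)) = 0.
  near: h; exact: (shift_cvg _ Psi0).
rewrite Psia sub0r normrN add0r.
set d := w (h + p0) - w p0 => Hd.
have -> : ((w \o shift p0) - (cst (w p0) + lL)) h = d - l h.
  by rewrite -[LHS]/(w (h + p0) - (w p0 + l h)) opprD addrA.
have dl : `|d| <= `|d - l h| + `|l h| by rewrite -[X in `|X| <= _](subrK (l h)) ler_normD.
have dlE : d - l h = mulmxr (invmx Q) ('d Psi a (h, d)).
  rewrite /= /l opprK (_ : (h, d) = (h, 0) + (0, d)); last first.
    by rewrite -[RHS]/(h + 0, 0 + d) addr0 add0r.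
  by rewrite linearD mulmxDl dPsi2 mulmxK // addrC.
have Kd : `|d - l h| <= K * `|'d Psi a (h, d)| by rewrite dlE; exact: QK.
move: Hd Kd dl (lK' h); rewrite [`|(h, d)|]/(Num.max `|h| `|d|) -[lL h]/(l h).
move: (normr_ge0 h) (normr_ge0 d).
move: `|h| `|d| `|d - l h| `|l h| `|'d Psi a (h, d)|.
move=> nh nd r nl N nh0 nd0 HN Hr Hnd Hnl.
have K'1 : 0 < 1 + 2 * K' by rewrite addr_gt0 ?mulr_gt0.
have e1 : K * e <= 2^-1.
  by rewrite mulrC -ler_pdivlMr // -invfM ge_min lexx.
have e2 : K * e * (1 + 2 * K') <= eps.
  by rewrite mulrAC -ler_pdivlMl ?mulr_gt0 // mulrC ge_min lexx orbT.
set M := Num.max nh nd in HN.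
have rM : r <= K * e * M by apply: le_trans Hr _; rewrite -mulrA ler_pM2l.
have M0 : 0 <= M by rewrite le_max nh0.
have Mh : M <= (1 + 2 * K') * nh.
  have rM2 : r <= 2^-1 * M by apply: le_trans rM _; rewrite ler_wpM2r.
  have K'nh : 0 <= K' * nh by rewrite mulr_ge0 // ltW.
  rewrite /M; case: (leP nh nd) rM2 => hd;
    rewrite /M ?(max_idPr hd) ?(max_idPl (ltW hd)) => rM2; lra.
apply: le_trans rM _; apply: le_trans (_ : K * e * ((1 + 2 * K') * nh) <= _).
  by rewrite ler_wpM2l // mulr_ge0 // ltW.
by rewrite mulrA ler_wpM2r.
Unshelve. all: by end_near.
Qed.
Lemma near_is_diff (U V : normedModType R) (f g df : U -> V) x :
  (\forall y \near x, f y = g y) -> is_diff x f df -> is_diff x g df.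
Proof.
move=> fg [fd <-].
have [d_cont /eqaddoP fE] := (diff_locallyP _ _).1 fd.
suff gE : g \o shift x = cst (g x) + 'd f x +o_ (0 : U) id.
  have dg := diff_unique d_cont gE.
  by split; [apply/diff_locallyP; rewrite dg | rewrite dg].
apply/eqaddoP => e e0.
have shift_cvg : (fun h : U => h + x) @ (0 : U) --> x.
  by rewrite -[X in _ --> X]add0r; apply: cvgD; [exact: cvg_id | exact: cvg_cst].
have fg0 : \forall h \near (0 : U), f (h + x) = g (h + x) by exact: (shift_cvg _ fg).
near=> h.
have fEh : `|f (h + x) - (f x + 'd f x h)| <= e * `|h| by near: h; exact: fE.
rewrite -[_ h]/(g (h + x) - (g x + 'd f x h)) -(nbhs_singleton fg).
suff <- : f (h + x) = g (h + x) by [].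
by near: h.
Unshelve. all: by end_near.
Qed.

Lemma is_diff_mulmxr p q (Q : 'M[R]_(p, q)) (x : 'rV[R]_p) :
  is_diff x (mulmxr Q : 'rV[R]_p -> 'rV[R]_q) (mulmxr Q).
Proof.
split; first exact: differentiable_mulmxr.
by rewrite diff_lin //; exact: mulmxr_continuous.
Qed.

Lemma is_diff_row_mx (U : normedModType R) p q (f df : U -> 'rV[R]_p)
    (g dg : U -> 'rV[R]_q) x :
  is_diff x f df -> is_diff x g dg ->
  is_diff x (fun y => row_mx (f y) (g y)) (fun v => row_mx (df v) (dg v)).
Proof.
have rowE (a : 'rV[R]_p) (b : 'rV[R]_q) :
    row_mx a b = mulmxr (row_mx 1%:M 0) a + mulmxr (row_mx 0 1%:M) b.
  by rewrite /= !mul_mx_row !mulmx0 !mulmx1 add_row_mx addr0 add0r.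
move=> fd gd.
have -> : (fun y => row_mx (f y) (g y)) =
    (mulmxr (row_mx 1%:M 0) \o f) + (mulmxr (row_mx 0 1%:M) \o g).
  by apply/funext => y; rewrite rowE.
have -> : (fun y => row_mx (df y) (dg y)) =
    (mulmxr (row_mx 1%:M 0) \o df) + (mulmxr (row_mx 0 1%:M) \o dg).
  by apply/funext => y; rewrite rowE.
by apply: is_diffD; apply: is_diff_comp; apply: is_diff_mulmxr.
Qed.

Lemma derive_coord_diff (U : normedModType R) n (f : U -> 'rV[R]_n) x v b :
  differentiable f x -> 'D_v (fun y => f y 0 b : R) x = 'd f x v 0 b.
Proof.
move=> fd; rewrite -deriveE // derive_mx ?mxE //; exact: diff_derivable.
Qed.

(** The blocks of partial derivatives represent the differential on row vectors. *)
Lemma diff_pair_mx m n (f : 'rV[R]_m * 'rV[R]_m -> 'rV[R]_n) p xi eta :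
  differentiable f p ->
  'd f p (xi, eta) =
    xi *m \matrix_(a, b) 'D_(delta_mx 0 a, 0) (fun q => f q 0 b : R) p +
    eta *m \matrix_(a, b) 'D_(0, delta_mx 0 a) (fun q => f q 0 b : R) p.
Proof.
move=> fd.
have -> : (xi, eta) = (xi, 0) + (0, eta).
  by rewrite -[RHS]/(xi + 0, 0 + eta) addr0 add0r.
rewrite linearD; congr (_ + _).
  rewrite mulmx_sum_row {1}(row_sum_delta xi).
  rewrite (big_morph (fun u => 'd f p (u, 0)) (id1 := 0) (op1 := +%R)); last 2 first.
  - move=> u v; rewrite -linearD; congr ('d f p _).
    by rewrite -[RHS]/(u + v, 0 + 0) addr0.
  - exact: linear0.
  apply: eq_bigr => a _.
  rewrite (_ : (_ *: delta_mx 0 a, 0) = xi 0 a *: (delta_mx 0 a, 0)); last first.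
    by rewrite -[RHS]/(xi 0 a *: delta_mx 0 a, xi 0 a *: 0) scaler0.
  rewrite linearZ; congr (_ *: _); apply/rowP => b.
  by rewrite !mxE derive_coord_diff.
rewrite mulmx_sum_row {1}(row_sum_delta eta).
rewrite (big_morph (fun u => 'd f p (0, u)) (id1 := 0) (op1 := +%R)); last 2 first.
- move=> u v; rewrite -linearD; congr ('d f p _).
  by rewrite -[RHS]/(0 + 0, u + v) addr0.
- exact: linear0.
apply: eq_bigr => a _.
rewrite (_ : (0, _ *: delta_mx 0 a) = eta 0 a *: (0, delta_mx 0 a)); last first.
  by rewrite -[RHS]/(eta 0 a *: 0, eta 0 a *: delta_mx 0 a) scaler0.
rewrite linearZ; congr (_ *: _); apply/rowP => b.
by rewrite !mxE derive_coord_diff.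
Qed.
End Calculus.

(** * The Lagrangian in charts *)

Section Lagrangian.
Variables (R : realType) (M : topologicalType) (m : nat).
Variables (A : manifold R M m) (L : M * M -> R).
Hypothesis L_C2 : C2_lagrangian A L.
Implicit Types c : chart R M m.

Lemma chart_mapK c x : atlas A c -> chart_dom c x -> chart_inv c (chart_map c x) = x.
Proof. by move=> /atlas_chart[_ _ + _ _]; exact. Qed.

Lemma chart_cod_map c x : chart_dom c x -> chart_cod c (chart_map c x).
Proof. by move=> xc; exists x. Qed.

Lemma chart_invK c u : atlas A c -> chart_cod c u -> chart_map c (chart_inv c u) = u.
Proof. by move=> ac [x xc <-]; rewrite chart_mapK. Qed.

Lemma chart_dom_inv c u : atlas A c -> chart_cod c u -> chart_dom c (chart_inv c u).
Proof. by move=> ac [x xc <-]; rewrite chart_mapK. Qed.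

(** The Lagrangian in a pair of charts. *)
Definition lag c c' (p : 'rV[R]_m * 'rV[R]_m) : R :=
  L (chart_inv c p.1, chart_inv c' p.2).

(** Its partial gradients, as row vectors. *)
Definition grad1 c c' p : 'rV[R]_m := \row_a 'D_(delta_mx 0 a, 0) (lag c c') p.
Definition grad2 c c' p : 'rV[R]_m := \row_a 'D_(0, delta_mx 0 a) (lag c c') p.

(** Partial derivatives of the gradients: row [a] of [hessrs] is the derivative
    of the gradient in the [s]-th variable in the direction of the [a]-th
    coordinate of the [r]-th variable. *)
Definition hess11 c c' p : 'M[R]_m :=
  \matrix_(a, b) 'D_(delta_mx 0 a, 0) (fun q => grad1 c c' q 0 b : R) p.
Definition hess21 c c' p : 'M[R]_m :=
  \matrix_(a, b) 'D_(0, delta_mx 0 a) (fun q => grad1 c c' q 0 b : R) p.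
Definition hess12 c c' p : 'M[R]_m :=
  \matrix_(a, b) 'D_(delta_mx 0 a, 0) (fun q => grad2 c c' q 0 b : R) p.
Definition hess22 c c' p : 'M[R]_m :=
  \matrix_(a, b) 'D_(0, delta_mx 0 a) (fun q => grad2 c c' q 0 b : R) p.

Lemma d1E c c' u v : atlas A c -> chart_cod c u ->
  d1 L c (chart_inv c u) (chart_inv c' v) = grad1 c c' (u, v).
Proof.
move=> ac cu; apply/rowP => a; rewrite !mxE chart_invK //.
rewrite -(@derive_affine _ _ _ _ (lag c c') (fun u => (u, v)) u (delta_mx 0 a)) //.
by move=> h; rewrite -[RHS]/(h *: delta_mx 0 a + u, h *: 0 + v) scaler0 add0r.
Qed.

Lemma d2E c c' u v : atlas A c' -> chart_cod c' v ->
  d2 L c' (chart_inv c u) (chart_inv c' v) = grad2 c c' (u, v).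
Proof.
move=> ac cv; apply/rowP => a; rewrite !mxE chart_invK //.
rewrite -(@derive_affine _ _ _ _ (lag c c') (fun v => (u, v)) v (delta_mx 0 a)) //.
by move=> h; rewrite -[RHS]/(h *: 0 + u, h *: delta_mx 0 a + v) scaler0 add0r.
Qed.

(** The rows of [Bmx] correspond to the first variable and those of [hess21] to
    the second one, whence the transposition. *)
Lemma BmxE c c' x y :
  Bmx L c c' x y = - (hess21 c c' (chart_map c x, chart_map c' y))^T.
Proof.
apply/matrixP => i j; rewrite !mxE; congr (- _).
set u := chart_map c x; set v := chart_map c' y.
rewrite -(@derive_affine _ _ _ _ (fun q => grad1 c c' q 0 i) (fun v => (u, v))
  v (delta_mx 0 j)); last first.
  by move=> h; rewrite -[RHS]/(h *: 0 + u, h *: delta_mx 0 j + v) scaler0 add0r.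
congr ('D_ _ _ _); apply/funext => v' /=; rewrite mxE.
rewrite -(@derive_affine _ _ _ _ (lag c c') (fun u => (u, v')) u (delta_mx 0 i)) //.
by move=> h; rewrite -[RHS]/(h *: delta_mx 0 i + u, h *: 0 + v') scaler0 add0r.
Qed.

Lemma differentiable_lag c c' p : atlas A c -> atlas A c' ->
  chart_cod c p.1 -> chart_cod c' p.2 -> differentiable (lag c c') p.
Proof. by move=> ac ac' p1 p2; have [+ _] := L_C2 ac ac'; apply. Qed.

Lemma differentiable_grad1 c c' p : atlas A c -> atlas A c' ->
  chart_cod c p.1 -> chart_cod c' p.2 -> differentiable (grad1 c c') p.
Proof.
move=> ac ac' p1 p2; apply: differentiable_rV => b.
have [_ /(_ (delta_mx 0 b, 0))[+ _]] := L_C2 ac ac'.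
move=> /(_ p (conj p1 p2)); congr (differentiable _ _).
by apply/funext => q; rewrite mxE.
Qed.

Lemma differentiable_grad2 c c' p : atlas A c -> atlas A c' ->
  chart_cod c p.1 -> chart_cod c' p.2 -> differentiable (grad2 c c') p.
Proof.
move=> ac ac' p1 p2; apply: differentiable_rV => b.
have [_ /(_ (0, delta_mx 0 b))[+ _]] := L_C2 ac ac'.
move=> /(_ p (conj p1 p2)); congr (differentiable _ _).
by apply/funext => q; rewrite mxE.
Qed.

Lemma diff_grad1 c c' p xi eta : differentiable (grad1 c c') p ->
  'd (grad1 c c') p (xi, eta) = xi *m hess11 c c' p + eta *m hess21 c c' p.
Proof. exact: diff_pair_mx. Qed.

Lemma diff_grad2 c c' p xi eta : differentiable (grad2 c c') p ->
  'd (grad2 c c') p (xi, eta) = xi *m hess12 c c' p + eta *m hess22 c c' p.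
Proof. exact: diff_pair_mx. Qed.
End Lagrangian.

(** * The derivative of the Poincare map *)

(** [differentiable_implicit] for [g2 (u, v) + g1 (v, w) = 0], where [w] is
    a function of [(u, v)]; the differential of [(u, v) -> (v, w)] is then a step
    of the recurrence. *)
Lemma is_diff_implicit_step (R : realType) m (g2 g1 : 'rV[R]_m * 'rV[R]_m -> 'rV[R]_m)
    (u0 u1 u2 : 'rV[R]_m) (S G E Q : 'M[R]_m) (w : 'rV[R]_(m + m) -> 'rV[R]_m) :
  let p0 := row_mx u0 u1 in
  differentiable g2 (u0, u1) ->
  (forall xi eta, 'd g2 (u0, u1) (xi, eta) = xi *m S + eta *m G) ->
  differentiable g1 (u1, u2) ->
  (forall xi eta, 'd g1 (u1, u2) (xi, eta) = xi *m E + eta *m Q) ->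
  Q \in unitmx -> {for p0, continuous w} -> w p0 = u2 ->
  (\forall p \near p0, g2 (lsubmx p, rsubmx p) + g1 (rsubmx p, w p) = 0) ->
  is_diff p0 (fun p => row_mx (rsubmx p) (w p))
    (mulmxr (block_mx 0 (- (S *m invmx Q)) 1%:M (- ((G + E) *m invmx Q)))).
Proof.
move=> p0 dg2 g2E dg1 g1E Q_unit w_cont wp0 Psi0.
have p0l : lsubmx p0 = u0 by rewrite row_mxKl.
have p0r : rsubmx p0 = u1 by rewrite row_mxKr.
pose Psi (q : 'rV[R]_(m + m) * 'rV[R]_m) : 'rV[R]_m :=
  g2 (lsubmx q.1, rsubmx q.1) + g1 (rsubmx q.1, q.2).
have lsub_diff : is_diff p0 (lsubmx : 'rV[R]_(m + m) -> 'rV[R]_m) lsubmx.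
  split; first exact: differentiable_lsubmx.
  by rewrite diff_lin //; exact: continuous_lsubmx.
have rsub_diff : is_diff p0 (rsubmx : 'rV[R]_(m + m) -> 'rV[R]_m) rsubmx.
  split; first exact: differentiable_rsubmx.
  by rewrite diff_lin //; exact: continuous_rsubmx.
have fst_diff : is_diff (p0, u2) (fst : 'rV[R]_(m + m) * 'rV[R]_m -> _) fst.
  have fst_cont : continuous (fst : 'rV[R]_(m + m) * 'rV[R]_m -> _).
    by move=> q; exact: cvg_fst.
  by split; [exact: linear_differentiable | rewrite diff_lin].
have snd_diff : is_diff (p0, u2) (snd : 'rV[R]_(m + m) * 'rV[R]_m -> _) snd.
  have snd_cont : continuous (snd : 'rV[R]_(m + m) * 'rV[R]_m -> _).
    by move=> q; exact: cvg_snd.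
  by split; [exact: linear_differentiable | rewrite diff_lin].
have lfst_diff := is_diff_comp fst_diff lsub_diff.
have rfst_diff := is_diff_comp fst_diff rsub_diff.
have Psi_diff : is_diff (p0, u2) Psi (fun q =>
   'd g2 (u0, u1) (lsubmx q.1, rsubmx q.1) +
   'd g1 (u1, u2) (rsubmx q.1, q.2)).
  apply: is_diffD.
    apply: (is_diff_comp (is_diff_pair lfst_diff rfst_diff)).
    by rewrite /= p0l p0r; exact: differentiableP.
  apply: (is_diff_comp (is_diff_pair rfst_diff snd_diff)).
  by rewrite /= p0r; exact: differentiableP.
case: Psi_diff => Psi_diff dPsi.
have dPsiE xi eta : 'd Psi (p0, u2) (xi, eta) =
    lsubmx xi *m S + rsubmx xi *m G
    + (rsubmx xi *m E + eta *m Q).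
  rewrite dPsi; exact: (congr2 +%R (g2E _ _) (g1E _ _)).
have dPsi2 eta : 'd Psi (p0, u2) (0, eta) = eta *m Q.
  rewrite dPsiE (_ : lsubmx _ = 0); last by apply/rowP => j; rewrite !mxE.
  rewrite (_ : rsubmx _ = 0); last by apply/rowP => j; rewrite !mxE.
  by rewrite !mul0mx !add0r.
have := differentiable_implicit w_cont.
rewrite wp0 => /(_ Psi Q Psi_diff dPsi2 Q_unit Psi0) [w_diff dw].
have row_diff : is_diff p0 (fun p => row_mx (rsubmx p) (w p))
   (fun xi => row_mx (rsubmx xi) ('d w p0 xi)).
  by apply: is_diff_row_mx; exact: differentiableP.
rewrite (_ : (mulmxr _ : _ -> _) = fun xi => row_mx (rsubmx xi) ('d w p0 xi)) //.
apply/funext => xi; rewrite dw dPsiE /=.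
rewrite -[xi in LHS]hsubmxK mul_row_block !mulmx0 mulmx1 add0r; congr row_mx.
rewrite mul0mx addr0 !mulmxN -opprD !mulmxA -mulmxDl; congr (- (_ *m _)).
by rewrite mulmxDr addrA.
Qed.

Section Branch.
Variables (R : realType) (M : topologicalType) (m : nat).
Variables (A : manifold R M m) (L : M * M -> R).
Hypothesis L_C2 : C2_lagrangian A L.
Implicit Types c : chart R M m.

Lemma chart_cod_open c : atlas A c -> open (chart_cod c).
Proof. by move=> /atlas_chart[]. Qed.

Lemma chart_dom_open c : atlas A c -> open (chart_dom c).
Proof. by move=> /atlas_chart[]. Qed.

Lemma chart_map_continuous c x :
  atlas A c -> chart_dom c x -> {for x, continuous (chart_map c)}.
Proof. by move=> /atlas_chart[_ _ _ + _]; apply. Qed.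

Lemma chart_inv_continuous c u :
  atlas A c -> chart_cod c u -> {for u, continuous (chart_inv c)}.
Proof. by move=> /atlas_chart[_ _ _ _]; apply. Qed.

Lemma pair_inv_continuous c c' x y : atlas A c -> atlas A c' ->
  chart_dom c x -> chart_dom c' y ->
  pair_inv c c' p @[p --> pair_map c c' (x, y)] --> (x, y).
Proof.
move=> ac ac' cx cy; rewrite /pair_inv /pair_map /=.
set u := chart_map c x; set v := chart_map c' y.
have Hx : (chart_inv c \o lsubmx) p @[p --> row_mx u v] -->
    chart_inv c (lsubmx (row_mx u v)).
  apply: continuous_comp; first exact: continuous_lsubmx.
  by rewrite row_mxKl; apply: chart_inv_continuous => //; exact: chart_cod_map.
have Hy : (chart_inv c' \o rsubmx) p @[p --> row_mx u v] -->
    chart_inv c' (rsubmx (row_mx u v)).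
  apply: continuous_comp; first exact: continuous_rsubmx.
  by rewrite row_mxKr; apply: chart_inv_continuous => //; exact: chart_cod_map.
rewrite row_mxKl (chart_mapK ac) // in Hx; rewrite row_mxKr (chart_mapK ac') // in Hy.
by refine (cvg_pair Hx Hy).
Qed.

Lemma near_pair_cod c c' x y : atlas A c -> atlas A c' ->
  chart_dom c x -> chart_dom c' y ->
  \forall p \near pair_map c c' (x, y),
    chart_cod c (lsubmx p) /\ chart_cod c' (rsubmx p).
Proof.
move=> ac ac' cx cy; rewrite /pair_map /=.
near=> p; split; near: p.
- apply: (@continuous_lsubmx R 1 m m).
  rewrite row_mxKl; apply: open_nbhs_nbhs; split; first exact: chart_cod_open.
  exact: chart_cod_map.
- apply: (@continuous_rsubmx R 1 m m).
  rewrite row_mxKr; apply: open_nbhs_nbhs; split; first exact: chart_cod_open.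
  exact: chart_cod_map.
Unshelve. all: by end_near.
Qed.

(** The differential of a branch of the discrete Lagrangian system in charts. *)
Lemma is_diff_branch c0 c1 c2 x0 x1 x2 (T : M * M -> M * M) :
  atlas A c0 -> atlas A c1 -> atlas A c2 ->
  chart_dom c0 x0 -> chart_dom c1 x1 -> chart_dom c2 x2 ->
  dls_branch A L T x0 x1 x2 ->
  let u0 := chart_map c0 x0 in let u1 := chart_map c1 x1 in
  let u2 := chart_map c2 x2 in
  let Q := hess21 L c1 c2 (u1, u2) in
  Q \in unitmx ->
  is_diff (pair_map c0 c1 (x0, x1)) (pair_map c1 c2 \o T \o pair_inv c0 c1)
    (mulmxr (block_mx 0 (- (hess12 L c0 c1 (u0, u1) *m invmx Q)) 1%:M
       (- ((hess22 L c0 c1 (u0, u1) + hess11 L c1 c2 (u1, u2)) *m invmx Q)))).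
Proof.
move=> a0 a1 a2 cx0 cx1 cx2 [Tx T_cont T_dls] u0 u1 u2 Q Q_unit.
set p0 := pair_map c0 c1 (x0, x1).
pose w (p : 'rV[R]_(m + m)) := chart_map c2 (T (pair_inv c0 c1 p)).2.
have p0l : lsubmx p0 = u0 by rewrite row_mxKl.
have p0r : rsubmx p0 = u1 by rewrite row_mxKr.
have inv_p0 : pair_inv c0 c1 p0 = (x0, x1).
  by rewrite /pair_inv p0l p0r !(chart_mapK (A := A)).
have inv_cvg : pair_inv c0 c1 @ p0 --> (x0, x1) by exact: pair_inv_continuous.
have T_cvg : T \o pair_inv c0 c1 @ p0 --> (x1, x2).
  by apply: cvg_comp inv_cvg _; rewrite -Tx; exact: T_cont.
have T2_cvg : (fun p => (T (pair_inv c0 c1 p)).2) @ p0 --> x2.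
  exact: (cvg_comp _ _ T_cvg (@cvg_snd _ _ _ _ _)).
have wp0 : w p0 = u2 by rewrite /w inv_p0 Tx.
have w_cont : {for p0, continuous w}.
  suff : w p @[p --> p0] --> w p0 by [].
  rewrite wp0; apply: cvg_comp T2_cvg _.
  exact: chart_map_continuous.
have near_p0 : \forall p \near p0, [/\ chart_cod c0 (lsubmx p), chart_cod c1 (rsubmx p),
    chart_dom c2 (T (pair_inv c0 c1 p)).2,
    (T (pair_inv c0 c1 p)).1 = chart_inv c1 (rsubmx p) &
    dls_equation A L (chart_inv c0 (lsubmx p)) (chart_inv c1 (rsubmx p))
        (T (pair_inv c0 c1 p)).2].
  have H1 := near_pair_cod a0 a1 cx0 cx1.
  have H2 : \forall p \near p0, chart_dom c2 (T (pair_inv c0 c1 p)).2.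
    by apply: T2_cvg; apply: open_nbhs_nbhs; split => //; exact: chart_dom_open.
  have H3 := inv_cvg _ T_dls.
  near=> p.
  have [] : chart_cod c0 (lsubmx p) /\ chart_cod c1 (rsubmx p) by near: p.
  have [] : (T (pair_inv c0 c1 p)).1 = (pair_inv c0 c1 p).2 /\
     dls_equation A L (pair_inv c0 c1 p).1 (pair_inv c0 c1 p).2
      (T (pair_inv c0 c1 p)).2 by near: p; exact: H3.
  by split=> //; near: p.
have Psi0 : \forall p \near p0,
    grad2 L c0 c1 (lsubmx p, rsubmx p) + grad1 L c1 c2 (rsubmx p, w p) = 0.
  apply: filterS near_p0 => p [c0p c1p c2p T1p].
  move=> /(_ c1 a1 (chart_dom_inv a1 c1p)).
  by rewrite (d2E _ _ _ a1) // -{1}(chart_mapK a2 c2p) (d1E _ _ _ a1).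
have c0u : chart_cod c0 u0 by exact: chart_cod_map.
have c1u : chart_cod c1 u1 by exact: chart_cod_map.
have c2u : chart_cod c2 u2 by exact: chart_cod_map.
have dg2 : differentiable (grad2 L c0 c1) (u0, u1).
  exact: (differentiable_grad2 L_C2).
have dg1 : differentiable (grad1 L c1 c2) (u1, u2).
  exact: (differentiable_grad1 L_C2).
have row_diff := is_diff_implicit_step dg2 (fun xi eta => diff_grad2 xi eta dg2) dg1
  (fun xi eta => diff_grad1 xi eta dg1) Q_unit w_cont wp0 Psi0.
apply: near_is_diff row_diff.
  apply: filterS near_p0 => p [_ c1p _ T1p _].
  by rewrite /= /pair_map T1p (chart_invK a1).
Unshelve. all: by end_near.
Qed.
End Branch.

Section Chain.
Variables (R : realType) (M : topologicalType) (m : nat).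
Variables (A : manifold R M m) (L : M * M -> R).
Hypothesis L_C2 : C2_lagrangian A L.
Variables (c : nat -> chart R M m) (x : nat -> M).
Hypothesis c_atlas : forall k, atlas A (c k).
Hypothesis c_around : forall k, chart_dom (c k) (x k).

(** The coordinates of the [k]-th link of the trajectory, and the second
    derivatives of the Lagrangian there. *)
Definition link k : 'rV[R]_m * 'rV[R]_m :=
  (chart_map (c k) (x k), chart_map (c k.+1) (x k.+1)).
Definition link11 k := hess11 L (c k) (c k.+1) (link k).
Definition link22 k := hess22 L (c k) (c k.+1) (link k).
Definition link12 k := hess12 L (c k) (c k.+1) (link k).
Definition link21 k := hess21 L (c k) (c k.+1) (link k).

(** The chain rule along the trajectory: the differential of an iterate of the
    branches is the transfer matrix of the linearized equations. *)
Lemma is_diff_branch_iter (T : int -> M * M -> M * M) :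
  (forall k, link21 k \in unitmx) ->
  (forall k, dls_branch A L (T k.+1%:Z) (x k.+1) (x k.+2) (x k.+3)) ->
  forall k, is_diff (pair_map (c 1) (c 2) (x 1, x 2))
    (pair_map (c k.+1) (c k.+2) \o branch_iter T k \o pair_inv (c 1) (c 2))
    (mulmxr (transfer (fun i => link12 i.+1) (fun i => link22 i.+1 + link11 i.+2)
                      (fun i => link21 i.+2) k)).
Proof.
move=> Q_unit T_branch k; set p0 := pair_map _ _ _.
have inv_cvg : pair_inv (c 1) (c 2) @ p0 --> (x 1, x 2).
  exact: (pair_inv_continuous (c_atlas 1) (c_atlas 2)).
have inv_p0 : pair_inv (c 1) (c 2) p0 = (x 1, x 2).
  by rewrite /pair_inv row_mxKl row_mxKr !(chart_mapK (A := A)).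
have iter_cvg j : branch_iter T j \o pair_inv (c 1) (c 2) @ p0 --> (x j.+1, x j.+2).
  elim: j => [|j IHj] //.
  have [Tx T_cont _] := T_branch j.
  rewrite -Tx; exact: (cvg_comp _ _ IHj T_cont).
have iter_p0 j : branch_iter T j (pair_inv (c 1) (c 2) p0) = (x j.+1, x j.+2).
  elim: j => [|j IHj] //=; rewrite IHj.
  by have [Tx _ _] := T_branch j.
elim: k => [|k IHk].
  apply: (@near_is_diff _ _ _ id).
    have := near_pair_cod (c_atlas 1) (c_atlas 2) (c_around 1) (c_around 2).
    apply: filterS => p [p1 p2].
    by rewrite /= /pair_map /= !(chart_invK (A := A)) // hsubmxK.
  rewrite (_ : (mulmxr _ : _ -> _) = id); last by apply/funext => xi; rewrite /= mulmx1.
  exact: is_diff_id.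
have := @is_diff_branch _ _ _ A L L_C2 (c k.+1) (c k.+2) (c k.+3)
  (x k.+1) (x k.+2) (x k.+3) _
  (c_atlas _) (c_atlas _) (c_atlas _) (c_around _) (c_around _) (c_around _)
  (T_branch k) (Q_unit k.+2).
set K := (pair_map (c k.+1) (c k.+2) \o _ \o _) in IHk.
have Kp0 : K p0 = pair_map (c k.+1) (c k.+2) (x k.+1, x k.+2) by rewrite /K /= iter_p0.
rewrite -Kp0 => T_diff.
have comp_diff := is_diff_comp IHk T_diff.
rewrite (_ : (mulmxr (transfer _ _ _ k.+1) : _ -> _) =
  mulmxr (recurrence_step (fun i => link12 i.+1)
    (fun i => link22 i.+1 + link11 i.+2) (fun i => link21 i.+2) k) \o
  mulmxr (transfer (fun i => link12 i.+1) (fun i => link22 i.+1 + link11 i.+2)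
                      (fun i => link21 i.+2) k)); last first.
  by apply/funext => xi; rewrite /= mulmxA.
apply: near_is_diff comp_diff.
(* near [p0] the iterates stay in the charts, so that passing to coordinates and
   back between two branches is the identity *)
have : \forall p \near p0, chart_dom (c k.+1) (branch_iter T k (pair_inv (c 1) (c 2) p)).1 /\
     chart_dom (c k.+2) (branch_iter T k (pair_inv (c 1) (c 2) p)).2.
  have H1 := cvg_comp _ _ (iter_cvg k) (@cvg_fst _ _ _ _ _).
  have H2 := cvg_comp _ _ (iter_cvg k) (@cvg_snd _ _ _ _ _).
  near=> p; split; near: p.
    apply: H1; apply: open_nbhs_nbhs; split => //; exact: (chart_dom_open (c_atlas _)).
  apply: H2; apply: open_nbhs_nbhs; split => //; exact: (chart_dom_open (c_atlas _)).
apply: filterS => p [d1 d2].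
rewrite /K /= /pair_inv /pair_map row_mxKl row_mxKr !(chart_mapK (A := A)) //.
by case: (branch_iter _ _ _).
Unshelve. all: by end_near.
Qed.

(** The Hessian of the action is block tridiagonal and cyclic. The terms are
    added with multiplicities, since for [n] equal to 1 or 2 several of the three
    block diagonals coincide. *)
Lemma action_hessianE n : (forall k, c (k + n)%N = c k) ->
  (forall k, x (k + n)%N = x k) ->
  forall (k j : 'I_n) a b,
  action_hessian L (fun i : 'I_n => c i.+1) (fun i : 'I_n => x i.+1)
    (mxvec_index k a) (mxvec_index j b) =
  ((link11 j.+1 + link22 (ord_pred j).+1) *+ (k == j) + link21 j.+1 *+ (k == ordS j)
       + link12 k.+1 *+ (j == ordS k)) a b.
Proof.
move=> cn xn k j a b.
rewrite /action_hessian /hessian mxE.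
set u0 := mxvec _.
(* [phi i] extracts the coordinates of the link starting at the [i]-th point *)
pose phi (i : 'I_n) (u : 'rV[R]_(n * m)) := (row i (vec_mx u), row (ordS i) (vec_mx u)).
pose lg (i : 'I_n) := lag L (c i.+1) (c i.+2).
have phi_u0 i : phi i u0 = link i.+1.
  by rewrite /phi /u0 mxvecK !rowK !periodic_ordS.
have phi_affine i h v u : phi i (h *: v + u) = h *: phi i v + phi i u.
  rewrite /phi !linearP; exact: erefl.
have phi_diff i u : differentiable (phi i) u.
  by apply: differentiable_pair; apply: differentiable_rV => l;
     under eq_fun do rewrite !mxE; exact: differentiable_coord.
have phi_near : \forall v \near u0, forall i : 'I_n,
    chart_cod (c i.+1) (phi i v).1 /\ chart_cod (c i.+2) (phi i v).2.
  suff phi_near (i : 'I_n) : \forall v \near u0,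
      chart_cod (c i.+1) (phi i v).1 /\ chart_cod (c i.+2) (phi i v).2.
    by near=> v; near: v; exact: filter_forall.
  have phi_cvg : phi i @ u0 --> link i.+1.
    by rewrite -phi_u0; exact: differentiable_continuous.
  have H1 := cvg_comp _ _ phi_cvg (@cvg_fst _ _ _ _ _).
  have H2 := cvg_comp _ _ phi_cvg (@cvg_snd _ _ _ _ _).
  near=> p; split; near: p.
    apply: H1; apply: open_nbhs_nbhs; split; first exact: (chart_cod_open (c_atlas _)).
    exact: chart_cod_map.
  apply: H2; apply: open_nbhs_nbhs; split; first exact: (chart_cod_open (c_atlas _)).
  exact: chart_cod_map.
have phi_delta i (l : 'I_n) d : phi i (delta_mx 0 (mxvec_index l d)) =
    (delta_mx 0 d *+ (l == i), delta_mx 0 d *+ (l == ordS i)).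
  rewrite /phi vec_mx_delta; congr (_, _); apply/rowP => e; rewrite !mxE;
    by rewrite eq_sym; case: (l == _); rewrite ?mulr1n ?mulr0n !mxE ?eqxx.
have lag_diff (i : 'I_n) v : chart_cod (c i.+1) (phi i v).1 ->
    chart_cod (c i.+2) (phi i v).2 -> differentiable (lg i) (phi i v).
  by move=> cv1 cv2; exact: (differentiable_lag L_C2).
have diff_lag (i : 'I_n) p d (b1 b2 : bool) : differentiable (lg i) p ->
    'd (lg i) p (delta_mx 0 d *+ b1, delta_mx 0 d *+ b2) =
    grad1 L (c i.+1) (c i.+2) p 0 d *+ b1 + grad2 L (c i.+1) (c i.+2) p 0 d *+ b2.
  move=> lgd.
  have -> : grad1 L (c i.+1) (c i.+2) p 0 d = 'd (lg i) p (delta_mx 0 d, 0).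
    by rewrite -deriveE // /grad1 mxE.
  have -> : grad2 L (c i.+1) (c i.+2) p 0 d = 'd (lg i) p (0, delta_mx 0 d).
    by rewrite -deriveE // /grad2 mxE.
  case: b1; case: b2; rewrite !(mulr1n, mulr0n) ?addr0 ?add0r ?linear0 //.
  rewrite -linearD; congr ('d _ _ _).
  by rewrite -[RHS]/(delta_mx 0 d + 0, 0 + delta_mx 0 d) addr0 add0r.
(* the gradient of the action on a neighbourhood of [u0]: only the link that
   starts and the link that ends at the [j]-th point contribute *)
have first_derivative v : (forall i : 'I_n,
    chart_cod (c i.+1) (phi i v).1 /\ chart_cod (c i.+2) (phi i v).2) ->
  'D_(delta_mx 0 (mxvec_index j b))
    (fun u => action L (fun i => chart_inv (c i.+1) (row i (vec_mx u)))) v =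
  grad1 L (c j.+1) (c j.+2) (phi j v) 0 b
  + grad2 L (c (ord_pred j).+1) (c (ord_pred j).+2) (phi (ord_pred j) v) 0 b.
  move=> cv.
  have -> : (fun u => action L
      (fun i => chart_inv (c i.+1) (row i (vec_mx u)))) =
      \sum_(i < n) (lg i \o phi i).
    apply/funext => u; rewrite fct_sumE; apply: eq_bigr => i _.
    by rewrite /lg /lag /= periodic_ordS.
  have lg_diff i : differentiable (lg i) (phi i v).
    by have [? ?] := cv i; exact: lag_diff.
  rewrite derive_sum; last first.
    by move=> i; apply: diff_derivable; exact: differentiable_comp.
  under eq_bigr => i _.
    rewrite (@derive_affine _ _ _ _ _ _ _ _ (phi i (delta_mx 0 (mxvec_index j b)))); last first.
      by move=> h; exact: phi_affine.
    rewrite deriveE // phi_delta diff_lag //.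
    over.
  rewrite big_split /=; congr (_ + _).
    by rewrite (@sum_mulrb_pick _ _ _ _ j) // => i /=; rewrite eq_sym.
  rewrite (@sum_mulrb_pick _ _ _ _ (ord_pred j)) // => i /=.
  apply/eqP/eqP => [->|->]; first by rewrite ordSK.
  by rewrite ord_predK.
rewrite (near_eq_derive (g := fun v => grad1 L (c j.+1) (c j.+2) (phi j v) 0 b
  + grad2 L (c (ord_pred j).+1) (c (ord_pred j).+2) (phi (ord_pred j) v) 0 b)); last first.
  near=> v; apply: first_derivative; near: v; exact: phi_near.
have d1 : differentiable (grad1 L (c j.+1) (c j.+2)) (link j.+1).
  by apply: (differentiable_grad1 L_C2) => //; exact: chart_cod_map.
set i := ord_pred j.
have d2 : differentiable (grad2 L (c i.+1) (c i.+2)) (link i.+1).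
  by apply: (differentiable_grad2 L_C2) => //; exact: chart_cod_map.
pose g1 (q : 'rV[R]_m * 'rV[R]_m) : R := grad1 L (c j.+1) (c j.+2) q 0 b.
pose g2 (q : 'rV[R]_m * 'rV[R]_m) : R := grad2 L (c i.+1) (c i.+2) q 0 b.
have g1d : differentiable g1 (link j.+1).
  exact: (differentiable_comp d1 (@differentiable_coord R 1 m _ 0 b)).
have g2d : differentiable g2 (link i.+1).
  exact: (differentiable_comp d2 (@differentiable_coord R 1 m _ 0 b)).
rewrite -[X in 'D_ _ X _]/((g1 \o phi j) + (g2 \o phi i)).
rewrite deriveD; last 2 first.
- by apply: diff_derivable; apply: differentiable_comp => //; rewrite phi_u0.
- by apply: diff_derivable; apply: differentiable_comp => //; rewrite phi_u0.
rewrite (@derive_affine _ _ _ _ g1 (phi j) _ _ (phi j (delta_mx 0 (mxvec_index k a))));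
  last by move=> h; exact: phi_affine.
rewrite (@derive_affine _ _ _ _ g2 (phi i) _ _ (phi i (delta_mx 0 (mxvec_index k a))));
  last by move=> h; exact: phi_affine.
rewrite !phi_u0 !phi_delta.
rewrite (derive_coord_diff _ _ d1) (derive_coord_diff _ _ d2).
have e1 xi eta : 'd (grad1 L (c j.+1) (c j.+2)) (link j.+1) (xi, eta) =
    xi *m link11 j.+1 + eta *m link21 j.+1 := diff_grad1 _ _ d1.
have e2 xi eta : 'd (grad2 L (c i.+1) (c i.+2)) (link i.+1) (xi, eta) =
    xi *m link12 i.+1 + eta *m link22 i.+1 := diff_grad2 _ _ d2.
apply: etrans (congr2 (fun X Y : 'rV[R]_m => X 0 b + Y 0 b) (e1 _ _) (e2 _ _)) _.
have SE : link12 i.+1 *+ (k == i) = link12 k.+1 *+ (j == ordS k).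
  have -> : (k == i) = (j == ordS k).
    by rewrite -(inj_eq (bij_inj (@ordS_bij n))) ord_predK eq_sym.
  by case: eqP => [jk|_]; [rewrite /i jk ordSK | rewrite !mulr0n].
move: (link11 _) (link22 _) (link21 _) (link12 i.+1) (link12 k.+1) SE => E G Q S S' SE.
have rowsel (t : bool) (X : 'M[R]_m) :
    ((delta_mx 0 a *+ t : 'rV[R]_m) *m X) 0 b = (X *+ t) a b.
  by case: t; [rewrite !mulr1n -rowE mxE | rewrite !mulr0n mul0mx !mxE].
have mxD p q (X Y : 'M[R]_(p, q)) s t : (X + Y) s t = X s t + Y s t by rewrite mxE.
rewrite !mxD !rowsel mulrnDl !mxD ord_predK SE.
by rewrite [X in _ + X = _]addrC addrA [X in X + _ = _]addrAC.
Unshelve. all: by end_near.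
Qed.
End Chain.

(** * The determinant formula *)

Lemma sgr_norm_inv (R : realFieldType) (p : R) : p != 0 -> Num.sg p * `|p|^-1 = p^-1.
Proof.
move=> p0; have [pp|pn|p00] := ltrgtP 0 p; last by rewrite -p00 eqxx in p0.
  by rewrite gtr0_sg // gtr0_norm // mul1r.
by rewrite ltr0_sg // ltr0_norm // invrN mulN1r opprK.
Qed.

Theorem theorem2p1 (R : realType) (M : topologicalType) (m : nat)
    (A : manifold R M m) (L : M * M -> R) (n : nat) (x : int -> M)
    (T : int -> M * M -> M * M) (c : int -> chart R M m)
    (L_C2 : C2_lagrangian A L)
    (n_gt0 : (0 < n)%N)
    (x_traj : periodic_trajectory A L n x)
    (L_twist : forall i : int,
       \forall p \near (x i, x (i + 1)), twist A L p.1 p.2)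
    (T_branch : forall i : int,
       dls_branch A L (T i) (x i) (x (i + 1)) (x (i + 2)))
    (c_periodic : forall i : int, c (i + n%:Z) = c i)
    (c_atlas : forall i : int, atlas A (c i))
    (c_around : forall i : int, chart_dom (c i) (x i)) :
  let B (i : nat) := Bmx L (c i%:Z) (c i.+1%:Z) (x i%:Z) (x i.+1%:Z) in
  let Tn := branch_iter T n in
  let P := derivative_mx (c 1) (c 2) Tn (x 1, x 2) in
  let H := action_hessian L (fun i : 'I_n => c i.+1%:Z)
                            (fun i : 'I_n => x i.+1%:Z) in
  let prodB := \prod_(1 <= i < n.+1) \det (B i) in
  let sigma := Num.sg prodB in
  let beta := `|prodB|^-1 in
  differentiable (in_pair_coords (c 1) (c 2) Tn)
                 (pair_map (c 1) (c 2) (x 1, x 2)) /\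
  \det (P - 1%:M) = (-1) ^+ m * \det H / prodB /\
  \det (P - 1%:M) = sigma * (-1) ^+ m * beta * \det H.
Proof.
move=> B Tn P H prodB sigma beta.
pose c' k := c k%:Z; pose x' k := x k%:Z.
have cn k : c' (k + n)%N = c' k by rewrite /c' PoszD c_periodic.
have xn k : x' (k + n)%N = x' k by rewrite /x' PoszD x_traj.1.
have c'_atlas k : atlas A (c' k) by exact: c_atlas.
have c'_around k : chart_dom (c' k) (x' k) by exact: c_around.
have detB k : \det (B k) = (-1) ^+ m * \det (link21 L c' x' k).
  by rewrite /B BmxE -scaleN1r detZ det_tr.
have detB_neq0 k : \det (B k) != 0.
  have := nbhs_singleton (L_twist k%:Z); rewrite -PoszD addn1 /=.
  by move=> /(_ (c k) (c k.+1)); apply.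
have Q_unit k : link21 L c' x' k \in unitmx.
  rewrite unitmxE unitfE; apply: contraNneq (detB_neq0 k) => detQ0.
  by rewrite detB detQ0 mulr0.
have T_branch' k : dls_branch A L (T k.+1%:Z) (x' k.+1) (x' k.+2) (x' k.+3).
  by have := T_branch k.+1%:Z; rewrite -!PoszD addn1 addn2.
set tr := transfer (fun i => link12 L c' x' i.+1)
  (fun i => link22 L c' x' i.+1 + link11 L c' x' i.+2)
  (fun i => link21 L c' x' i.+2) n.
have Tn_diff : is_diff (pair_map (c 1) (c 2) (x 1, x 2))
    (in_pair_coords (c 1) (c 2) Tn) (mulmxr tr).
  have := is_diff_branch_iter L_C2 c'_atlas c'_around Q_unit T_branch' n.
  by rewrite -[n.+1]add1n -[n.+2]add2n !cn.
case: Tn_diff => Tn_diff dTn.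
have PE : P = tr.
  by apply/row_matrixP => i; rewrite !rowE mul_rV_lin1 dTn.
(* the size [m + m] is even *)
have detP : \det (P - 1%:M) = \det (1%:M - tr).
  by rewrite PE -opprB -scaleN1r detZ -signr_odd oddD addbb mul1r.
have detH : \det H = (-1) ^+ (n.-1 * m) *
    (\prod_(i < n) \det (link21 L c' x' i.+1)) * \det (1%:M - tr).
  apply: (det_periodic_tridiag n_gt0 _ _ Q_unit
    (action_hessianE L_C2 c'_atlas c'_around cn xn)).
    by move=> k; rewrite /link11 /link -!addSn !cn !xn.
  by move=> k; rewrite /link21 /link -!addSn !cn !xn.
have prodBE : prodB = (-1) ^+ (n * m) * \prod_(i < n) \det (link21 L c' x' i.+1).
  rewrite /prodB big_add1 big_mkord; under eq_bigr do rewrite detB.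
  by rewrite big_split /= prodr_const card_ord -exprM mulnC.
have prodB_neq0 : prodB != 0.
  rewrite /prodB big_add1 big_mkord; apply/prodf_neq0 => i _; exact: detB_neq0.
have main : \det (P - 1%:M) = (-1) ^+ m * \det H / prodB.
  apply: (canRL (mulfK prodB_neq0)); rewrite detP detH prodBE.
  have -> : (n * m = m + n.-1 * m)%N by rewrite -mulSn prednK.
  by rewrite exprD; ring.
split; first exact: Tn_diff.
split; first exact: main.
by rewrite main -(sgr_norm_inv prodB_neq0) /sigma /beta; ring.
Qed.
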